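(* Let $\mathcal{A}$ be a compact IRU-set of non-negative real $(M\times N)$-matrices and let $\mathcal{E}$ be a compact IRU-set of non-negative real $(N\times M)$-matrices. Then the matrix multiplication game $(\mathcal{A},\mathcal{E})$ is determined, and moreover both Adam and Eve possess constant optimal strategies.
   Context: IRU-sets: given nonempty sets $\mathcal{R}_1,\dots,\mathcal{R}_p$ of $q$-dimensional row vectors, the IRU-set (independent row uncertainty set) formed by them is the set of all $(p\times q)$-matrices whose $i$-th row belongs to $\mathcal{R}_i$ for every $i$. Matrix multiplication game (MMG) $(\mathcal{A},\mathcal{E})$: here $\mathcal{A}$ is a nonempty set of $(M\times N)$-matrices and $\mathcal{E}$ a nonempty set of $(N\times M)$-matrices. For $i=1,2,\dots$ Adam writes $A_i\in\mathcal{A}$ and then Eve writes $E_i\in\mathcal{E}$. A strategy for Adam is a function $\sigma:(\mathcal{A}\cdot\mathcal{E})^*\to\mathcal{A}$ mapping every finite history to his next move; a strategy for Eve is a function $\tau:(\mathcal{A}\cdot\mathcal{E})^*\cdot\mathcal{A}\to\mathcal{E}$. A strategy is constant if it always chooses one and the same matrix, independently of the history. A pair $(\sigma,\tau)$ determines a unique infinite play $A_1E_1A_2E_2\cdots$, whose payoff (paid by Adam to Eve) is $$P(\sigma,\tau)=\limsup_{k\to\infty}\Big\|\prod_{i=1}^k A_iE_i\Big\|^{1/k},$$ the product being taken in the order $A_1E_1A_2E_2\cdots A_kE_k$, where $\|\cdot\|$ is the entrywise $1$-norm. Adam minimizes and Eve maximizes the payoff. The game is determined with value $V$ if $\inf_\sigma\sup_\tau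 P(\sigma,\tau)=\sup_\tau\inf_\sigma P(\sigma,\tau)=V$. A strategy $\sigma$ of Adam is optimal if $P(\sigma,\tau)\le V$ for all $\tau$; a strategy $\tau$ of Eve is optimal if $P(\sigma,\tau)\ge V$ for all $\sigma$. *)

(* Defs.v *)
From HB Require Import structures.
From mathcomp Require Import all_boot all_order all_algebra.
From mathcomp Require Import all_classical all_reals all_analysis.

Set Implicit Arguments.
Unset Strict Implicit.
Unset Printing Implicit Defensive.

Import Order.TTheory GRing.Theory Num.Theory.
Import numFieldNormedType.Exports.

Local Open Scope classical_set_scope.
Local Open Scope ring_scope.

Definition IRU_set_of (R : realType) (p q : nat)
    (rows : 'I_p -> set 'rV[R]_q) : set 'M[R]_(p, q) :=
  [set X | forall i, rows i (row i X)].

Definition is_IRU_set (R : realType) (p q : nat) (S : set 'M[R]_(p, q)) : Prop :=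
  exists rows : 'I_p -> set 'rV[R]_q,
    (forall i, rows i !=set0) /\ S = IRU_set_of rows.

Definition nonneg_mx (R : realType) (p q : nat) (X : 'M[R]_(p, q)) : Prop :=
  forall i j, 0 <= X i j.

(* The norm that mathcomp-analysis attaches to matrices is the max norm,
   hence this separate definition of the entrywise 1-norm. *)
Definition mx_norm1 (R : realType) (p q : nat) (X : 'M[R]_(p, q)) : R :=
  \sum_i \sum_j `|X i j|.

Section MatrixMultiplicationGame.
Variables (R : realType) (M N : nat).
Variables (A : set 'M[R]_(M, N)) (E : set 'M[R]_(N, M)).

(* [:: (A_1, E_1); ...; (A_k, E_k)], in chronological order; A and E used as
   types are the subtypes of their elements. *)
Definition history := seq (A * E).

Definition adam_strategy := history -> A.

(* tau h a is the answer of Eve to the history h followed by the move a. *)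
Definition eve_strategy := history -> A -> E.

Definition constant_adam (sigma : adam_strategy) : Prop :=
  exists a : A, forall h, sigma h = a.

Definition constant_eve (tau : eve_strategy) : Prop :=
  exists e : E, forall h a, tau h a = e.

Fixpoint play (sigma : adam_strategy) (tau : eve_strategy) (k : nat) : history :=
  if k is k'.+1 then
    let h := play sigma tau k' in
    let a := sigma h in
    rcons h (a, tau h a)
  else [::].

Definition history_prod (h : history) : 'M[R]_M :=
  \big[mulmx/1%:M]_(ae <- h) (val ae.1 *m val ae.2).

(* The sequence is indexed by the number k.+1 >= 1 of rounds. The payoff is an
   extended real because the norms need not be bounded for arbitrary A and E. *)
Definition payoff (sigma : adam_strategy) (tau : eve_strategy) : \bar R :=
  limn_esup (fun k : nat =>
    (mx_norm1 (history_prod (play sigma tau k.+1)) `^ (k.+1%:R^-1))%:E).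

Definition upper_value : \bar R :=
  ereal_inf [set ereal_sup [set payoff sigma tau | tau in [set: eve_strategy]]
            | sigma in [set: adam_strategy]].

Definition lower_value : \bar R :=
  ereal_sup [set ereal_inf [set payoff sigma tau | sigma in [set: adam_strategy]]
            | tau in [set: eve_strategy]].

Definition determined_with_value (V : R) : Prop :=
  upper_value = V%:E /\ lower_value = V%:E.

Definition optimal_adam (V : R) (sigma : adam_strategy) : Prop :=
  forall tau : eve_strategy, (payoff sigma tau <= V%:E)%E.

Definition optimal_eve (V : R) (tau : eve_strategy) : Prop :=
  forall sigma : adam_strategy, (V%:E <= payoff sigma tau)%E.

End MatrixMultiplicationGame.

(* Main.v *)
Require Import Defs.
From HB Require Import structures.
From mathcomp Require Import all_boot all_order all_algebra.
From mathcomp Require Import all_classical all_reals all_analysis.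
From mathcomp Require Import lra.

Set Implicit Arguments.
Unset Strict Implicit.
Unset Printing Implicit Defensive.

Import Order.TTheory GRing.Theory Num.Theory.
Import numFieldNormedType.Exports.

Local Open Scope classical_set_scope.
Local Open Scope ring_scope.

(** The constant strategy a of Adam guarantees every payoff exceeding l as soon
    as some x > 0 satisfies a e x <= l x for all e in E, and the constant
    strategy e of Eve guarantees l as soon as some y >= 0, y <> 0, satisfies
    a e y >= l y for all a in A. Since rows are chosen independently, min_a and
    max_e are attained simultaneously in all rows, so both inequalities concern
    one monotone homogeneous operator T x = min_a max_e a e x. For l < m, either
    T x <= m x for some x > 0 or T y >= l y for some y >= 0, y <> 0: iterate
    x |-> max (1, T x / l) from 1; if an increment is small the first
    alternative holds, otherwise the iterates are unbounded and the normalised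
    ones accumulate at a y as required. The value V is the largest l that Eve
    can guarantee in this way. A limit a of moves of Adam guaranteeing V + d,
    d -> 0, is optimal: otherwise the alternative for the game ({a}, E) gives
    Eve a vector y with a e y >= l y and l > V, and this survives, on the
    support of y, when a is slightly perturbed. *)

(** * Entrywise order, rowwise extrema and compactness *)

Definition le_cv (R : realType) (n : nat) (u v : 'cV[R]_n) : Prop :=
  forall i, u i 0 <= v i 0.

Section Cone.
Variable R : realType.

Lemma le_cv_trans n (v u w : 'cV[R]_n) : le_cv u v -> le_cv v w -> le_cv u w.
Proof. by move=> uv vw i; apply: le_trans (uv i) (vw i). Qed.

Lemma exprn_powR n (x : R) : 0 <= x -> (x ^+ n.+1) `^ n.+1%:R^-1 = x.
Proof. by move=> x0; rewrite -powR_mulrn // -powRrM mulfV ?pnatr_eq0 // powRr1. Qed.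

Lemma nonneg_mulmx p q r (X : 'M[R]_(p, q)) (Y : 'M[R]_(q, r)) :
  nonneg_mx X -> nonneg_mx Y -> nonneg_mx (X *m Y).
Proof. by move=> X0 Y0 i j; rewrite mxE sumr_ge0 // => k _; exact: mulr_ge0. Qed.

Lemma le_mulmx p q (X : 'M[R]_(p, q)) u v :
  nonneg_mx X -> le_cv u v -> le_cv (X *m u) (X *m v).
Proof. by move=> X0 uv i; rewrite !mxE ler_sum // => k _; exact: ler_wpM2l. Qed.

Lemma mulmx_col_continuous (T : topologicalType) p q
    (X : T -> 'M[R]_(p, q)) (v : T -> 'cV[R]_q) :
  (forall i j, continuous (fun t => X t i j)) ->
  (forall j, continuous (fun t => v t j 0)) ->
  forall i, continuous (fun t => (X t *m v t) i 0).
Proof.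
move=> cX cv i.
rewrite (_ : (fun t => _) = fun t => \sum_j X t i j * v t j 0); last first.
  by apply/funext => t; rewrite mxE.
apply: continuous_big => [|j _ t]; first exact: add_continuous.
by apply: continuousM; [exact: cX|exact: cv].
Qed.

(** By compactness each row has its own maximiser; stacking row [i] of the [i]-th maximiser stays in
    an IRU-set. *)
Lemma IRU_rowwise_max p q (S : set 'M[R]_(p, q)) (v : 'cV[R]_q) :
  is_IRU_set S -> compact S ->
  exists2 X, S X & forall Y, S Y -> le_cv (Y *m v) (X *m v).
Proof.
move=> [rows [rows0 ->]] cS.
have S0 : IRU_set_of rows !=set0.
  have [f fP] := choice rows0.
  by exists (\matrix_i f i) => i; rewrite rowK.
have best i : exists X, IRU_set_of rows X /\
    forall Y, IRU_set_of rows Y -> (Y *m v) i 0 <= (X *m v) i 0.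
  have [|X XS Xmax] := @compact_EVT_max _ R (fun X : 'M[R]_(p, q) => (X *m v) i 0) _ S0 cS.
    apply: continuous_subspaceT; apply: mulmx_col_continuous => [i' j|j].
      exact: coord_continuous.
    exact: cst_continuous.
  exists X; split; first exact: set_mem.
  by move=> Y YS; apply: Xmax; rewrite inE.
have [f fP] := choice best.
exists (\matrix_i row i (f i)).
  by move=> i; rewrite rowK; exact: (fP i).1.
move=> Y YS i; apply: le_trans ((fP i).2 Y YS) _.
by rewrite !mxE ler_sum // => k _; rewrite !mxE.
Qed.

Lemma IRU_rowwise_min p q (S : set 'M[R]_(p, q)) (v : 'cV[R]_q) :
  is_IRU_set S -> compact S ->
  exists2 X, S X & forall Y, S Y -> le_cv (X *m v) (Y *m v).
Proof.
move=> IS cS; have [X SX Xmax] := IRU_rowwise_max (- v) IS cS.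
exists X => // Y SY i; have := Xmax Y SY i.
by rewrite !mulmxN !mxE lerN2.
Qed.

(** The sets [G d] generate a proper filter as [d] tends to 0, and compactness of [K] gives it a
    cluster point. *)
Lemma compact_nested (T : topologicalType) (K : set T) (G : R -> set T) :
  compact K -> (forall d : R, 0 < d -> G d !=set0) ->
  (forall d : R, 0 < d -> G d `<=` K) ->
  (forall d d' : R, 0 < d -> d <= d' -> G d `<=` G d') ->
  exists2 p, K p & forall d : R, 0 < d -> closure (G d) p.
Proof.
move=> cK G0 GK Gmono.
pose F := filter_from [set d : R | 0 < d] G.
have FF : ProperFilter F.
  apply: filter_from_proper; last by move=> d; exact: G0.
  apply: filter_from_filter; first by exists 1; exact: ltr01.
  move=> d d' d0 d'0; exists (Num.min d d'); first by rewrite /= lt_min d0.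
  by move=> p Gp; split; apply: Gmono Gp; rewrite ?lt_min ?d0 // ge_min lexx ?orbT.
have FK : F K by exists 1; [exact: ltr01|apply: GK; exact: ltr01].
have [p [Kp clp]] := cK F FF FK.
exists p => // d d0 B Bp; apply: clp => //.
by exists d.
Qed.

Lemma closure_ge0 (T : topologicalType) (f : T -> R) (G : set T) p :
  continuous f -> (forall t, G t -> 0 <= f t) -> closure G p -> 0 <= f p.
Proof.
move=> cf Gf clp.
have cl : closed (f @^-1` [set x | 0 <= x]).
  by apply: closed_comp; [move=> ? _; exact: cf|exact: closed_ge].
by move: (closureS Gf clp); rewrite -(closure_id _).1.
Qed.

End Cone.

(** * Certificates for constant strategies and their duality *)

Section Certificates.
Variables (R : realType) (M N : nat).
Implicit Types (A : set 'M[R]_(M, N)) (E : set 'M[R]_(N, M)).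

(* Up to scaling, x >= 1 means x > 0; with this normalisation the sum of the
   entries of a non-negative P is at most that of P x. *)
Definition adam_cert E (a : 'M[R]_(M, N)) (l : R) : Prop :=
  exists2 x : 'cV[R]_M, (forall i, 1 <= x i 0) &
    forall e, E e -> le_cv (a *m (e *m x)) (l *: x).

(** Scaling [y] to sum 1 confines it to a compact simplex, so that certificates pass to limits; zero
    entries remain allowed. *)
Definition eve_cert A (e : 'M[R]_(N, M)) (l : R) : Prop :=
  exists y : 'cV[R]_M, [/\ nonneg_mx y, \sum_i y i 0 = 1 &
    forall a, A a -> le_cv (l *: y) (a *m (e *m y))].

(** Weak duality, in the manner of the Collatz-Wielandt bounds on the spectral radius of
    [a *m e]. *)
Lemma cert_le A E a e (l m : R) : A a -> E e -> nonneg_mx a -> nonneg_mx e ->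
  eve_cert A e l -> adam_cert E a m -> l <= m.
Proof.
move=> Aa Ee a0 e0 [y [y0 y1 ly]] [x x1 xm].
have x0 i : 0 < x i 0 by apply: lt_le_trans (x1 i).
have [i0 yi0] : exists i, y i 0 != 0.
  apply/existsP; apply: contraT; rewrite negb_exists => /forallP yz.
  move: y1; rewrite big1 => [/eqP|i _]; first by rewrite eq_sym oner_eq0.
  by have /negPn/eqP := yz i.
(* At an index maximising y / x, the bounds on a e y and a e x compare. *)
pose i := [arg max_(i > i0) (y i 0 / x i 0)]%O.
have imax j : y j 0 / x j 0 <= y i 0 / x i 0.
  by rewrite /i; case: Order.TotalTheory.arg_maxP => // k _; exact.
set s := y i 0 / x i 0 in imax.
have s0 : 0 < s.
  apply: lt_le_trans (imax i0); rewrite divr_gt0 //.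
  by rewrite lt_neqAle eq_sym yi0 y0.
have ysx : le_cv y (s *: x) by move=> j; rewrite mxE -ler_pdivrMr.
have yE : y i 0 = s * x i 0 by rewrite /s divfK // gt_eqF.
have := ly a Aa i; rewrite mxE => ly1.
have : (a *m (e *m y)) i 0 <= s * (m * x i 0).
  apply: le_trans (le_mulmx a0 (le_mulmx e0 ysx) i) _.
  rewrite -!scalemxAr mxE ler_pM2l //.
  by have := xm e Ee i; rewrite [leRHS]mxE.
move=> /(le_trans ly1); rewrite yE mulrCA ler_pM2l // ler_pM2r //.
Qed.

Lemma adam_certW E a (l m : R) : l <= m -> adam_cert E a l -> adam_cert E a m.
Proof.
move=> lm [x x1 xl]; exists x => // e Ee i; apply: le_trans (xl e Ee i) _.
by rewrite !mxE ler_wpM2r // (le_trans _ (x1 i)).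
Qed.

(** Compactness of [E] and of the simplex yields a limit pair [(e, y)], at which the additive slack
    [d] vanishes. *)
Lemma eve_cert_closed A E l : compact E ->
  (forall d : R, 0 < d -> exists2 e, E e & exists y : 'cV[R]_M,
    [/\ nonneg_mx y, \sum_i y i 0 = 1 &
      forall a, A a -> le_cv (l *: y) (a *m (e *m y) + const_mx d)]) ->
  exists2 e, E e & eve_cert A e l.
Proof.
move=> cE H.
(* The vectors [y] are stored as rows, so that compactness of boxes of row vectors applies. *)
pose K := E `*` [set y : 'rV[R]_M | forall i, [set` `[0, 1]] (y 0 i)].
have cK : compact K.
  apply: compact_setX => //.
  by apply: (@rV_compact R M (fun=> [set` `[0, 1]])) => i; exact: segment_compact.
pose G (d : R) := [set p : 'M[R]_(N, M) * 'rV[R]_M | [/\ K p,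
  \sum_i p.2 0 i = 1 & forall a, A a -> forall i,
  0 <= (a *m (p.1 *m p.2^T)) i 0 + d - l * p.2 0 i]].
have c1 i j : continuous (fun p : 'M[R]_(N, M) * 'rV[R]_M => p.1 i j).
  move=> p; apply: (@continuous_comp _ _ _ fst (fun e : 'M[R]_(N, M) => e i j)).
    exact: cvg_fst.
  exact: coord_continuous.
have c2 j : continuous (fun p : 'M[R]_(N, M) * 'rV[R]_M => p.2 0 j).
  move=> p; apply: (@continuous_comp _ _ _ snd (fun e : 'rV[R]_M => e 0 j)).
    exact: cvg_snd.
  exact: coord_continuous.
have [|||p Kp clp] := compact_nested (G := G) cK.
- move=> d /H [e Ee [y [y0 y1 ly]]]; exists (e, y^T); split => /=.
  + split => //= i; rewrite mxE /= in_itv /= y0 /= -y1 (bigD1 i) //=.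
    by rewrite lerDl sumr_ge0.
  + by rewrite -y1; apply: eq_bigr => i _; rewrite mxE.
  + move=> a Aa i; have := ly a Aa i; rewrite !trmxK subr_ge0.
    by rewrite [(l *: y) i 0]mxE [(_ + const_mx d) i 0]mxE [const_mx d i 0]mxE [y^T _ _]mxE.
- by move=> d _ p [].
- move=> d d' _ dd' p [Kp p1 Gp]; split=> // a Aa i.
  by apply: le_trans (Gp a Aa i) _; rewrite lerD2r lerD2l.
have [Ep /= Ip] := Kp.
have cs : continuous (fun p : 'M[R]_(N, M) * 'rV[R]_M => \sum_i p.2 0 i).
  by apply: continuous_big => [|j _]; [exact: add_continuous|exact: c2].
exists p.1 => //; exists p.2^T; split.
- move=> i j; rewrite (ord1 j) mxE.
  by have := Ip i; rewrite in_itv /= => /andP[].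
- transitivity (\sum_i p.2 0 i); first by apply: eq_bigr => i _; rewrite mxE.
  (* The sum condition passes to the closure as two opposite inequalities; the choice [d = 1] is
     arbitrary. *)
  apply/eqP; rewrite eq_le; apply/andP.
  split; rewrite -subr_ge0; have := clp 1 ltr01.
  apply: (@closure_ge0 R _ (fun p : 'M[R]_(N, M) * 'rV[R]_M => 1 - \sum_i p.2 0 i) (G 1)).
      by move=> q; apply: continuousB; [exact: cst_continuous|exact: cs].
    by move=> q [_ -> _]; rewrite subrr.
  apply: (@closure_ge0 R _ (fun p : 'M[R]_(N, M) * 'rV[R]_M => \sum_i p.2 0 i - 1) (G 1)).
    by move=> q; apply: continuousB; [exact: cs|exact: cst_continuous].
  by move=> q [_ -> _]; rewrite subrr.
move=> a Aa i; rewrite !mxE; apply/ler_addgt0Pr => d d0.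
rewrite -subr_ge0 -[X in X + d - _](_ : (a *m (p.1 *m p.2^T)) i 0 = _); last by rewrite mxE.
pose f (q : 'M[R]_(N, M) * 'rV[R]_M) :=
  (a *m (q.1 *m q.2^T)) i 0 + d - l * q.2 0 i.
apply: (@closure_ge0 _ _ f (G d)) (clp d d0); last by move=> q [_ _]; exact.
have cAE : continuous (fun q : 'M[R]_(N, M) * 'rV[R]_M =>
    (a *m (q.1 *m q.2^T)) i 0).
  apply: mulmx_col_continuous => [i' j|j]; first exact: cst_continuous.
  apply: mulmx_col_continuous => // j'.
  rewrite (_ : (fun _ => _) = fun t : 'M[R]_(N, M) * 'rV[R]_M => t.2 0 j') //.
  by apply/funext => t; rewrite mxE.
rewrite /f => q.
apply: (@cvgB R R^o); last first.
  by apply: (@cvgM R); [exact: cvg_cst|exact: c2].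
by apply: (@cvgD R R^o); [exact: cAE|exact: cvg_cst].
Qed.

(** Rowwise optimisers are assumed in place of the IRU property, which covers a singleton [A] at
    once. *)
Lemma cert_alternative A E (l m : R) : compact E ->
  (forall a, A a -> nonneg_mx a) -> (forall e, E e -> nonneg_mx e) ->
  (forall z, exists2 a, A a & forall a', A a' -> le_cv (a *m z) (a' *m z)) ->
  (forall x, exists2 e, E e & forall e', E e' -> le_cv (e' *m x) (e *m x)) ->
  0 < l -> l < m ->
  (exists2 a, A a & adam_cert E a m) \/ (exists2 e, E e & eve_cert A e l).
Proof.
move=> cE A0 E0 minA maxE l0 lm.
have /choice[fA fAP] : forall z, exists a, A a /\
    forall a', A a' -> le_cv (a *m z) (a' *m z).
  by move=> z; have [a] := minA z; exists a.
have /choice[fE fEP] : forall x, exists e, E e /\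
    forall e', E e' -> le_cv (e' *m x) (e *m x).
  by move=> x; have [e] := maxE x; exists e.
(* Eve's choice depends on [x] alone: every [a] is non-negative, so maximising [e *m x] rowwise
   maximises [a *m (e *m x)] for all [a] at once. *)
pose T (x : 'cV[R]_M) : 'cV[R]_M := fA (fE x *m x) *m (fE x *m x).
have T_mono x x' : le_cv x x' -> le_cv (T x) (T x').
  move=> xx'; have a0 := A0 _ (fAP (fE x' *m x')).1.
  apply: le_cv_trans ((fAP (fE x *m x)).2 _ (fAP (fE x' *m x')).1) _.
  apply: le_mulmx => //.
  apply: le_cv_trans (le_mulmx (E0 _ (fEP x).1) xx') _.
  exact: (fEP x').2 _ (fEP x).1.
pose f (x : 'cV[R]_M) : 'cV[R]_M := \col_i Num.max 1 (T x i 0 / l).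
pose x n := iter n f (const_mx 1).
have xS n i : x n.+1 i 0 = Num.max 1 (T (x n) i 0 / l) by rewrite /x iterS mxE.
have x1 n i : 1 <= x n i 0.
  by case: n => [|n]; [rewrite mxE|rewrite xS le_max lexx].
have x_incr n : le_cv (x n) (x n.+1).
  elim: n => [|n IH] i; first by rewrite [leLHS]mxE.
  rewrite xS [leRHS]xS ge_max !le_max lexx /=; apply/orP; right.
  by rewrite ler_pM2r ?invr_gt0 // T_mono.
pose s n := \sum_i x n i 0.
(* With this threshold, [l * (u + d) = l * u + (m - l) <= m * u] for every [u >= 1]. *)
pose d := (m - l) / l.
have d0 : 0 < d by rewrite divr_gt0 // subr_gt0.
have [[n sn]|big] := pselect (exists n, s n.+1 <= s n + d).
  left; exists (fA (fE (x n) *m x n)); first exact: (fAP _).1.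
  exists (x n) => // e Ee.
  apply: le_cv_trans (le_mulmx (A0 _ (fAP _).1) ((fEP (x n)).2 e Ee)) _ => i.
  rewrite -/(T (x n)) [leRHS]mxE.
  (* No entry decreases, so the increase of the sum bounds that of each entry. *)
  have step : x n.+1 i 0 <= x n i 0 + d.
    move: sn; rewrite /s (bigD1 i) //= [X in _ <= X + _ -> _](bigD1 i) //=.
    have : \sum_(j | j != i) x n j 0 <= \sum_(j | j != i) x n.+1 j 0.
      by apply: ler_sum => j _; exact: x_incr.
    by lra.
  have Tx : T (x n) i 0 <= l * x n.+1 i 0.
    by rewrite mulrC -ler_pdivrMr // xS le_max lexx orbT.
  apply: le_trans Tx _; have dl : l * d = m - l by rewrite /d mulrC divfK ?gt_eqF.
  have : l * x n.+1 i 0 <= l * (x n i 0 + d) by rewrite ler_pM2l.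
  have := x1 n i; have : 0 <= m - l by rewrite subr_ge0 ltW.
  move: (x n i 0) (x n.+1 i 0) => u v; rewrite mulrDr dl; nra.
right; apply: eve_cert_closed => // eps eps0.
(* Every step adds more than [d] to the sum, so [s n] eventually reaches [l / eps]. *)
have s_ge n : n%:R * d <= s n.
  elim: n => [|n IH]; first by rewrite mul0r sumr_ge0 // => i _; rewrite mxE.
  have : s n + d < s n.+1.
    by rewrite ltNge; apply/negP => sn; apply: big; exists n.
  by rewrite -natr1 mulrDl mul1r; lra.
have [n ns] : exists n, l / eps <= s n.
  exists (Num.bound (l / eps / d)).
  apply: le_trans (s_ge _); rewrite -ler_pdivrMr //.
  by apply/ltW/archi_boundP/ltW; do 2! apply: divr_gt0 => //.
have s0 : 0 < s n by apply: lt_le_trans ns; rewrite divr_gt0.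
exists (fE (x n)); first exact: (fEP _).1.
exists ((s n)^-1 *: x n); split.
- move=> i j; rewrite (ord1 j) mxE mulr_ge0 ?invr_ge0 ?(ltW s0) //.
  exact: le_trans (x1 n i).
- transitivity (\sum_i (s n)^-1 * x n i 0).
    by apply: eq_bigr => i _; rewrite mxE.
  by rewrite -mulr_sumr mulVf // gt_eqF.
move=> a Aa i; rewrite -!scalemxAr.
rewrite [leLHS]mxE [in leLHS]mxE [leRHS]mxE [X in _ <= X + _]mxE [X in _ <= _ + X]mxE.
have aT : T (x n) i 0 <= (a *m (fE (x n) *m x n)) i 0 by exact: (fAP _).2.
have aT0 : 0 <= (a *m (fE (x n) *m x n)) i 0.
  apply: (nonneg_mulmx (A0 a Aa) (nonneg_mulmx (E0 _ (fEP (x n)).1) _)) => i' j.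
  by rewrite (ord1 j); apply: le_trans (x1 n i').
(* [l * x n.+1] is the maximum of [l] and [T (x n)], both at most the right side; dividing by [s n]
   shrinks the extra [l] to at most [eps]. *)
have key : l * x n i 0 <= l + (a *m (fE (x n) *m x n)) i 0.
  apply: (@le_trans _ _ (l * x n.+1 i 0)); first by rewrite ler_pM2l // x_incr.
  rewrite xS mulrC -ler_pdivlMr // ge_max ler_pdivlMr // mul1r lerDl aT0 /=.
  by rewrite ler_pM2r ?invr_gt0 // (le_trans aT) // lerDr ltW.
rewrite mulrCA mulrC -ler_pdivlMr ?invr_gt0 // invrK mulrDl mulrAC mulVf ?gt_eqF //.
rewrite mul1r addrC (le_trans key) // lerD2r.
by rewrite mulrC -ler_pdivrMr.
Qed.

Lemma adam_cert_closure A E a (V : R) : compact E ->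
  (forall a, A a -> nonneg_mx a) -> (forall e, E e -> nonneg_mx e) ->
  (forall x, exists2 e, E e & forall e', E e' -> le_cv (e' *m x) (e *m x)) ->
  0 <= V -> A a ->
  (forall d, 0 < d -> closure [set b | A b /\ adam_cert E b (V + d)] a) ->
  forall l : R, V < l -> adam_cert E a l.
Proof.
move=> cE A0 E0 maxE V0 Aa cla l Vl.
(* Four equal steps: if the claim fails, Eve gets [V + 3 * d] against [a]; a nearby [b] leaves her
   [V + 2 * d], but the certificate of [b] caps this at [V + d]. *)
pose d := (l - V) / 4.
have d0 : 0 < d by rewrite /d; lra.
have lE : l = V + 4 * d by rewrite /d; lra.
have [||||||[_ -> //]|[e Ee [y [y0 y1 ly]]]] :=
    @cert_alternative [set a] E (V + 3 * d) l cE.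
- by move=> _ ->; exact: A0.
- exact: E0.
- by move=> z; exists a => // _ -> i.
- exact: maxE.
- lra.
- lra.
(* On the support of [y] the strict inequality is open in [b]; elsewhere the certificate only asks
   for non-negativity. *)
pose U i := [set b : 'M[R]_(M, N) |
  0 < y i 0 -> (V + 2 * d) * y i 0 < (b *m (e *m y)) i 0].
have aU : nbhs a [set b | forall i, U i b].
  apply: (@filter_forall _ _ U (nbhs a)) => i.
  have [yi|yi] := ltP 0 (y i 0); last first.
    by apply: nearW => b; rewrite /U /= ltNge yi.
  have cb : continuous (fun b : 'M[R]_(M, N) => (b *m (e *m y)) i 0).
    apply: mulmx_col_continuous => [i' j|j]; first exact: coord_continuous.
    exact: cst_continuous.
  have ay : (V + 2 * d) * y i 0 < (a *m (e *m y)) i 0.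
    apply: lt_le_trans (ly a erefl i); rewrite mxE ltr_pM2r //; lra.
  by apply: filterS (cvgr_gt (FF := nbhs_filter a) _ (cb a) _ ay) => b yb _.
have [b [[Ab bcert] bU]] := cla d d0 _ aU.
suff : V + 2 * d <= V + d by lra.
apply: (@cert_le [set b] E b e) => //; [exact: A0|exact: E0|].
exists y; split=> // _ -> i; rewrite mxE.
have := y0 i 0; rewrite le_eqVlt => /predU1P[<-|yi]; last exact/ltW/bU.
rewrite mulr0; exact: (nonneg_mulmx (A0 b Ab) (nonneg_mulmx (E0 e Ee) y0)).
Qed.

End Certificates.

(** * From certificates to bounds on the payoff *)

Section Payoff.
Variables (R : realType) (M N : nat).
Variables (A : set 'M[R]_(M, N)) (E : set 'M[R]_(N, M)).
Hypothesis A_ge0 : forall X, A X -> nonneg_mx X.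
Hypothesis E_ge0 : forall X, E X -> nonneg_mx X.
Implicit Types (h : history A E).
Implicit Types (sigma : adam_strategy A E) (tau : eve_strategy A E).

Lemma history_prod_rcons h ae :
  history_prod (rcons h ae) = history_prod h *m (val ae.1 *m val ae.2).
Proof.
rewrite /history_prod; elim: h => [|b h IH]; first by rewrite big_seq1_id big_nil mulmx1 mul1mx.
by rewrite rcons_cons !big_cons IH mulmxA.
Qed.

Lemma history_prod_ge0 h : nonneg_mx (history_prod h).
Proof.
elim/last_ind: h => [|h [a e] IH].
  by move=> i j; rewrite /history_prod big_nil mxE ler0n.
rewrite history_prod_rcons; apply: nonneg_mulmx => //=.
apply: nonneg_mulmx; [apply: A_ge0|apply: E_ge0].
  exact: set_mem (valP a).
exact: set_mem (valP e).
Qed.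

Lemma mx_norm1_history_prod h :
  mx_norm1 (history_prod h) = \sum_i \sum_j history_prod h i j.
Proof.
by apply: eq_bigr => i _; apply: eq_bigr => j _; rewrite ger0_norm // history_prod_ge0.
Qed.

(** By induction [P k *m x <= m ^+ k *: x]; as [x >= 1], the norm of [P k] is at most [m ^+ k] times
    a constant, which the roots remove in the limit. Only [m > l] is asked, since [l] itself may
    have no certificate. *)
Lemma payoff_le sigma tau (a : A) (l : R) : 0 <= l -> (forall h, sigma h = a) ->
  (forall m : R, l < m -> adam_cert E (val a) m) -> (payoff sigma tau <= l%:E)%E.
Proof.
move=> l0 sa cert; apply/lee_addgt0Pr => d d0; rewrite -EFinD.
have [|x x1 xl] := cert (l + d / 2); first by rewrite ltrDl divr_gt0.
set m := l + d / 2 in xl; have m0 : 0 < m by rewrite /m; lra.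
pose P k := history_prod (play sigma tau k).
have Px k : le_cv (P k *m x) (m ^+ k *: x).
  elim: k => [|k IH]; first by rewrite /P /= /history_prod big_nil mul1mx scale1r.
  rewrite /P /= history_prod_rcons /= sa -!mulmxA.
  apply: le_cv_trans (le_mulmx (@history_prod_ge0 _) (xl _ (set_mem (valP _)))) _.
  rewrite -scalemxAr exprS -scalerA => i; rewrite mxE [leRHS]mxE ler_pM2l //.
pose C := \sum_i x i 0.
have normP k : mx_norm1 (P k) <= m ^+ k * C.
  rewrite mx_norm1_history_prod /C mulr_sumr; apply: ler_sum => i _.
  apply: le_trans (_ : (P k *m x) i 0 <= _); last first.
    by apply: le_trans (Px k i) _; rewrite mxE.
  rewrite mxE; apply: ler_sum => j _.
  by rewrite -[leLHS]mulr1 ler_wpM2l // history_prod_ge0.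
have C0 : 0 <= C by apply: sumr_ge0 => i _; apply: le_trans (x1 i).
(* The room between [m] and [l + d] absorbs [C], by the Bernoulli-type bound
   [(r - 1) * k <= r ^+ k]. *)
pose r := (l + d) / m.
have r1 : 1 < r by rewrite /r ltr_pdivlMr // mul1r /m; lra.
have [K KC] : exists K, forall k, (K <= k)%N -> C <= r ^+ k.
  exists (Num.bound (C / (r - 1))) => k Kk.
  have r10 : 0 < r - 1 by rewrite subr_gt0.
  have Ck : C <= (r - 1) * k%:R.
    rewrite mulrC -ler_pdivrMr //.
    apply: le_trans (_ : (Num.bound (C / (r - 1)))%:R <= _); last by rewrite ler_nat.
    by apply/ltW/archi_boundP; rewrite divr_ge0 // ltW.
  apply: le_trans Ck _; elim: k {Kk} => [|k IH]; first by rewrite mulr0.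
  have rk : 1 <= r ^+ k by rewrite exprn_ege1 // ltW.
  rewrite -natr1 mulrDr mulr1 exprS.
  have : 0 <= (r - 1) * (r ^+ k - 1) by rewrite mulr_ge0 ?subr_ge0 // ltW.
  by move: IH; move: (r ^+ k) k%:R => u v; nra.
apply: ge_ereal_inf; exists (ereal_sup
    ((fun k => (mx_norm1 (P k.+1) `^ (k.+1%:R^-1))%:E) @` [set k | (K <= k)%N])).
  by exists [set k | (K <= k)%N] => //; exists K.
apply: ge_ereal_sup => _ [k /= Kk <-]; rewrite lee_fin.
have Pk : mx_norm1 (P k.+1) <= (l + d) ^+ k.+1.
  apply: le_trans (normP _) _; rewrite -[l + d](@divfK _ m) ?gt_eqF // -/r exprMn mulrC.
  by rewrite ler_pM2r ?exprn_gt0 // KC // ltnW.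
have ld0 : 0 <= l + d by lra.
rewrite -[leRHS](exprn_powR k) //.
apply: ge0_ler_powR; rewrite ?nnegrE ?invr_ge0 ?exprn_ge0 //.
by rewrite mx_norm1_history_prod; do 2! apply: sumr_ge0 => ? _; apply: history_prod_ge0.
Qed.

Lemma payoff_ge sigma tau (l : R) :
  (forall k, l <= mx_norm1 (history_prod (play sigma tau k.+1)) `^ (k.+1%:R^-1)) ->
  (l%:E <= payoff sigma tau)%E.
Proof.
move=> lP; apply: le_ereal_inf_tmp => _ [B [K _ KB] <-].
apply: ereal_sup_ge; exists
  (mx_norm1 (history_prod (play sigma tau K.+1)) `^ (K.+1%:R^-1))%:E.
  by exists K => //; apply: KB => /=.
by rewrite lee_fin.
Qed.

Lemma payoff_ge0 sigma tau : (0%:E <= payoff sigma tau)%E.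
Proof. by apply: payoff_ge => k; exact: powR_ge0. Qed.

(** By induction [l ^+ n *: y <= P n *m y]; the entries of [y] are at most 1 and sum to 1, so the
    norm is at least [l ^+ n] in every round, with no constant. *)
Lemma payoff_ge_cert sigma tau (e : E) (l : R) : 0 <= l -> (forall h a, tau h a = e) ->
  eve_cert A (val e) l -> (l%:E <= payoff sigma tau)%E.
Proof.
move=> l0 te [y [y0 y1 ly]]; apply: payoff_ge => k.
pose P k := history_prod (play sigma tau k).
have Py n : le_cv (l ^+ n *: y) (P n *m y).
  elim: n => [|n IH]; first by rewrite /P /= /history_prod big_nil mul1mx scale1r.
  rewrite /P /= history_prod_rcons /= te -!mulmxA.
  apply: le_cv_trans (le_mulmx (@history_prod_ge0 _) (ly _ (set_mem (valP _)))).
  rewrite -scalemxAr exprS -scalerA => i; rewrite mxE [leRHS]mxE ler_wpM2l //.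
have Pk : l ^+ k.+1 <= mx_norm1 (P k.+1).
  rewrite mx_norm1_history_prod -[leLHS]mulr1 -y1 mulr_sumr; apply: ler_sum => i _.
  have := Py k.+1 i; rewrite mxE => /le_trans; apply.
  rewrite mxE; apply: ler_sum => j _.
  rewrite -[leRHS]mulr1 ler_wpM2l ?history_prod_ge0 // -y1 (bigD1 j) //= lerDl.
  by apply: sumr_ge0.
rewrite -[leLHS](exprn_powR k) //.
apply: ge0_ler_powR; rewrite ?nnegrE ?invr_ge0 ?exprn_ge0 //.
by apply: le_trans Pk; exact: exprn_ge0.
Qed.

Lemma optimal_determined V sigma tau :
  optimal_adam V sigma -> optimal_eve V tau -> determined_with_value A E V.
Proof.
move=> osigma otau; split; apply/eqP; rewrite eq_le; apply/andP; split.
- apply: ge_ereal_inf; exists (ereal_sup [set payoff sigma t | t in [set: eve_strategy A E]]).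
    by exists sigma.
  by apply: ge_ereal_sup => _ [t _ <-].
- apply: le_ereal_inf_tmp => _ [s _ <-].
  by apply: ereal_sup_ge; exists (payoff s tau) => //; exists tau.
- apply: ge_ereal_sup => _ [t _ <-].
  by apply: ge_ereal_inf; exists (payoff sigma t) => //; exists sigma.
- apply: ereal_sup_ge; exists (ereal_inf [set payoff s tau | s in [set: adam_strategy A E]]).
    by exists tau.
  by apply: le_ereal_inf_tmp => _ [s _ <-].
Qed.

End Payoff.

(** * The value as a supremum, and the two optimal moves *)

Theorem theorem13 (R : realType) (M N : nat)
    (A : set 'M[R]_(M, N)) (E : set 'M[R]_(N, M))
    (A_IRU : is_IRU_set A) (A_compact : compact A)
    (A_ge0 : forall X, A X -> nonneg_mx X)
    (E_IRU : is_IRU_set E) (E_compact : compact E)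
    (E_ge0 : forall X, E X -> nonneg_mx X) :
  exists V : R,
    [/\ determined_with_value A E V,
        (exists sigma : adam_strategy A E,
           constant_adam sigma /\ optimal_adam V sigma)
      & (exists tau : eve_strategy A E,
           constant_eve tau /\ optimal_eve V tau)].
Proof.
have minA z := IRU_rowwise_min z A_IRU A_compact.
have maxE x := IRU_rowwise_max x E_IRU E_compact.
(* Payoffs are non-negative, so Eve secures 0 anyway; including it makes [S] non-empty and gives
   [V >= 0]. *)
pose S := [set l : R | l = 0 \/ exists2 e, E e & eve_cert A e l].
have S0 : S 0 by left.
have Sub : has_ubound S.
  have [e1 E1 e1max] := maxE (const_mx 1).
  have [a1 A1 _] := minA 0.
  pose z : 'cV_M := a1 *m (e1 *m const_mx 1).
  have z0 : nonneg_mx z.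
    apply: nonneg_mulmx; [exact: A_ge0|].
    by apply: nonneg_mulmx; [exact: E_ge0|move=> i j; rewrite mxE].
  have L0 : 0 <= \sum_i z i 0 by apply: sumr_ge0.
  (* The all-ones vector certifies [a1] at the sum of the entries of [z], which dominates each
     entry; weak duality then bounds [S]. *)
  exists (\sum_i z i 0) => l [->//|[e Ee ecert]].
  apply: (cert_le A1 Ee (A_ge0 _ A1) (E_ge0 _ Ee) ecert).
  exists (const_mx 1) => [i|e' Ee' i]; first by rewrite mxE.
  apply: le_trans (le_mulmx (A_ge0 _ A1) (e1max e' Ee') i) _.
  rewrite -/z [leRHS]mxE [X in _ * X]mxE mulr1 (bigD1 i) //= lerDl.
  by apply: sumr_ge0.
have Ssup : has_sup S by split => //; exists 0.
pose V := sup S.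
have V0 : 0 <= V by apply: ub_le_sup.
have [a Aa acert] : exists2 a, A a & forall l, V < l -> adam_cert E a l.
  have [|||a Aa cla] :=
      @compact_nested R _ A (fun d => [set b | A b /\ adam_cert E b (V + d)]) A_compact.
  - move=> d d0.
    (* Eve has no certificate at [V + d / 2], which exceeds the supremum, so Adam has one at
       [V + d]. *)
    have [||[a Aa acert]|[e Ee ecert]] := @cert_alternative R M N A E
      (V + d / 2) (V + d) E_compact A_ge0 E_ge0 minA maxE; [lra|lra|by exists a|].
    suff : V + d / 2 <= V by lra.
    by apply: ub_le_sup => //; right; exists e.
  - by move=> d _ b [].
  - move=> d d' _ dd' b [Ab bcert]; split=> //.
    by apply: adam_certW bcert; rewrite lerD2l.
  by exists a => //; exact: (adam_cert_closure E_compact A_ge0).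
pose sigma : adam_strategy A E := fun=> exist _ a (mem_set Aa).
have osigma : optimal_adam V sigma.
  by move=> tau; apply: (payoff_le A_ge0 E_ge0 _ V0 (fun=> erefl)).
have [tau [ctau otau]] : exists tau : eve_strategy A E,
    constant_eve tau /\ optimal_eve V tau.
  (* For [V = 0] there may be no certificates to pass to the limit, but then every move of Eve is
     optimal. *)
  have [VE|Vn0] := eqVneq V 0.
    have [e Ee _] := maxE 0.
    exists (fun _ _ => exist _ e (mem_set Ee)); split; first by eexists.
    by move=> s; rewrite VE; exact: payoff_ge0.
  have Vgt0 : 0 < V by rewrite lt_neqAle eq_sym Vn0.
  have [|e Ee ecert] := @eve_cert_closed R M N A E V E_compact.
    move=> d d0.
    (* The minimum with [V] forces [l > 0], so [l] comes with a certificate; since [y <= 1], the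
       loss [d * y] fits into the slack [d]. *)
    have [|l Sl Vl] := @sup_adherent R S (Num.min d V) _ Ssup.
      by rewrite lt_min d0.
    move: Vl; rewrite -/V => Vl.
    have [l0|[e Ee [y [y0 y1 ly]]]] := Sl.
      by move: Vl; rewrite l0 subr_lt0 lt_min ltxx andbF.
    exists e => //; exists y; split=> // b Ab i.
    have yle1 : y i 0 <= 1 by rewrite -y1 (bigD1 i) //= lerDl sumr_ge0.
    have dV : V - d <= l.
      by apply: le_trans (ltW Vl); rewrite lerD2l lerN2 ge_min lexx.
    have := ly b Ab i; rewrite mxE => lyi.
    rewrite mxE [leRHS]mxE [X in _ <= _ + X]mxE.
    have : (l - (V - d)) * y i 0 >= 0 by rewrite mulr_ge0 ?subr_ge0.
    have : d * y i 0 <= d by rewrite ler_piMr // ltW.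
    by move: lyi; lra.
  exists (fun _ _ => exist _ e (mem_set Ee)); split; first by eexists.
  by move=> s; apply: (payoff_ge_cert A_ge0 E_ge0 _ V0 (fun _ _ => erefl)).
exists V; split.
- exact: optimal_determined osigma otau.
- by exists sigma; split=> //; exists (exist _ a (mem_set Aa)).
- by exists tau.
Qed.
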